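(* Let $G$ be a group and $\mathcal{C}_G^\times$ a $G$-crossed braided tensor category extending a unitary modular tensor category $\mathcal{C}_{\mathbf 0}$, such that $G$ does not permute the anyons, with chosen Abelian defects $0_{\mathbf k}$ satisfying $0_{\mathbf k}\times0_{\mathbf l}=\mathfrak{w}(\mathbf k,\mathbf l)\times0_{\mathbf{kl}}$. Let $\mathbf g\in G$ with $\mathbf g^n=\mathbf 0$ (the identity) and $(0_{\mathbf g})^n=f\in\mathcal{A}$. Let $\mathbf r_1,\mathbf r_2\in G$ be elements (magnetic translations) which commute with each other and with $\mathbf g$, and such that ${}^{\mathbf r_i}0_{\mathbf g}=0_{\mathbf g}$ for $i=1,2$. Put $\mathfrak{b}(\mathbf r_1,\mathbf r_2)=\mathfrak{w}(\mathbf r_1,\mathbf r_2)\,\overline{\mathfrak{w}(\mathbf r_2,\mathbf r_1)}\in\mathcal{A}$. Then the quantity $\eta_{0_{\mathbf g}}(\mathbf r_1,\mathbf r_2)/\eta_{0_{\mathbf g}}(\mathbf r_2,\mathbf r_1)$ is gauge invariant (under vertex basis and symmetry action gauge transformations) and $$\left(\frac{\eta_{0_{\mathbf g}}(\mathbf r_1,\mathbf r_2)}{\eta_{0_{\mathbf g}}(\mathbf r_2,\mathbf r_1)}\right)^n=M_{f,\mathfrak{b}(\mathbf r_1,\mathbf r_2)} .$$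
   Context: $\mathcal{C}_{\mathbf 0}$ is a unitary modular tensor category (its simple objects are ''anyons''); $\mathcal{A}$ is the finite Abelian group of Abelian (quantum dimension 1) anyons under fusion, with $\overline{b}$ the inverse of $b$; $M_{a,b}=R^{a,b}R^{b,a}$ for $b\in\mathcal{A}$. $\mathbf 0$ denotes the identity of $G$, $\bar{\mathbf g}=\mathbf g^{-1}$. A $G$-crossed braided tensor category (BTC) $\mathcal{C}_G^\times=\bigoplus_{\mathbf g\in G}\mathcal{C}_{\mathbf g}$ is a $G$-graded unitary fusion-type category with trivial component $\mathcal{C}_{\mathbf 0}$, a $G$-action $x\mapsto{}^{\mathbf k}x$ mapping $\mathcal{C}_{\mathbf g}\to\mathcal{C}_{\mathbf{kgk}^{-1}}$, and a $G$-crossed braiding ($c_{\mathbf k}\times a_{\mathbf g}={}^{\mathbf k}a_{\mathbf g}\times c_{\mathbf k}$). Simple objects of $\mathcal{C}_{\mathbf g}$ are called $\mathbf g$-defects; a defect is Abelian if it has quantum dimension 1. Skeletally it is given by data $\{F,R,U,\eta\}$: $F$-symbols satisfying the pentagon equation; $G$-crossed $R$-symbols; phases/matrices $U_{\mathbf k}(a,b;c)$ for the action of $\mathbf k$ on splitting spaces; phases $\eta_x(\mathbf g,\mathbf h)$ relating the action of $\mathbf{gh}$ to the composition of the actions, with $U_{\mathbf 0}=1$, $\eta_0=1$, $\eta_x(\mathbf g,\mathbf 0)=\eta_x(\mathbf 0,\mathbf h)=1$. For Abelian objects subscripts are dropped, and for $a\in\mathcal{C}_{\mathbf g},b\in\mathcal{C}_{\mathbf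 h},c\in\mathcal{C}_{\mathbf k}$ the consistency equations read $R^{a,c}F^{a,c,{}^{\bar{\mathbf k}}b}R^{b,c}=F^{c,{}^{\bar{\mathbf k}}a,{}^{\bar{\mathbf k}}b}\,U_{\mathbf k}(a,b)\,R^{ab,c}F^{a,b,c}$, $(R^{c,a})^{-1}F^{a,{}^{\bar{\mathbf g}}c,b}(R^{{}^{\bar{\mathbf g}}c,b})^{-1}=F^{c,a,b}\,\eta_c(\mathbf g,\mathbf h)\,(R^{c,ab})^{-1}F^{a,b,{}^{\bar{\mathbf h}\bar{\mathbf g}}c}$, $\eta_x(\mathbf g,\mathbf h)\eta_x(\mathbf{gh},\mathbf k)=\eta_{{}^{\bar{\mathbf g}}x}(\mathbf h,\mathbf k)\eta_x(\mathbf g,\mathbf{hk})$, $\eta_a(\mathbf k,\mathbf l)\eta_b(\mathbf k,\mathbf l)U_{\mathbf l}({}^{\bar{\mathbf k}}a,{}^{\bar{\mathbf k}}b)U_{\mathbf k}(a,b)=U_{\mathbf{kl}}(a,b)\eta_{ab}(\mathbf k,\mathbf l)$. Since $G$ acts trivially on anyons, each $\mathcal{C}_{\mathbf k}$ contains an Abelian defect; one, $0_{\mathbf k}$, is chosen for each $\mathbf k$ ($0_{\mathbf 0}$ trivial), and $\mathfrak{w}$ is an $\mathcal{A}$-valued 2-cocycle. Gauge transformations. Vertex basis: $\eta$ is unchanged. Symmetry action (phases $\gamma_a(\mathbf k)$, with $\gamma_0(\mathbf k)=\gamma_a(\mathbf 0)=1$): $\eta_x(\mathbf g,\mathbf h)\to\frac{\gamma_x(\mathbf{gh})}{\gamma_x(\mathbf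 g)\gamma_{{}^{\bar{\mathbf g}}x}(\mathbf h)}\eta_x(\mathbf g,\mathbf h)$. *)

(* Defs.v *)
From HB Require Import structures.
From mathcomp Require Import all_boot all_order all_algebra.
From mathcomp Require Import reals.
From mathcomp Require Import complex.

Set Implicit Arguments.
Unset Strict Implicit.
Unset Printing Implicit Defensive.

Import Order.TTheory GRing.Theory Num.Theory.
Local Open Scope ring_scope.

(* [G]-crossed braided tensor categories are presented skeletally: fusion rules,
   together with the symbols F, R, U, eta in chosen bases of the splitting
   spaces V^{ab}_c.  The group [G] may be infinite; each sector C_g has
   finitely many simple objects, listed by [defects X g]. *)

Record gcfusion (G : groupType) := GCFusion {
  obj :> choiceType;                       (* simple objects of all sectors *)
  vac : obj;                               (* the trivial anyon 0 *)
  gr : obj -> G;                           (* a is in C_(gr a) *)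
  defects : G -> seq obj;
  dual : obj -> obj;
  fusN : obj -> obj -> obj -> nat;         (* N_{ab}^c = dim V^{ab}_c *)
  act : G -> obj -> obj;                   (* act k x = {}^k x *)

  defects_uniq : forall g, uniq (defects g);
  mem_defects : forall g x, (x \in defects g) = (gr x == g);

  fusN_gr : forall a b c, fusN a b c != 0%N -> gr c = (gr a * gr b)%g;
  fusN0l : forall a b, fusN vac a b = (a == b);
  fusN0r : forall a b, fusN a vac b = (a == b);
  fusNA : forall a b c d,
    (\sum_(e <- defects (gr a * gr b)%g) fusN a b e * fusN e c d
     = \sum_(f <- defects (gr b * gr c)%g) fusN b c f * fusN a f d)%N;
  fusN_dual : forall a b, fusN a b vac = (b == dual a);
  dualK : involutive dual;

  act1 : forall x, act 1%g x = x;
  actM : forall k l x, act (k * l)%g x = act k (act l x);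
  act_gr : forall k x, gr (act k x) = (k * gr x * k^-1)%g;
  act_vac : forall k, act k vac = vac;
  fusN_act : forall k a b c, fusN (act k a) (act k b) (act k c) = fusN a b c;
  fusN_crossed : forall c a d, fusN c a d = fusN (act (gr c) a) c d
}.

Arguments vac {G}.
Arguments defects {G}.

(* Basis vectors of V^{ab}_c are numbered by i < fusN a b c; the symbols are
   total in these numbers but only the values within range are meaningful.
   With k = gr b in R and bars denoting inverse group actions:
   [symF a b c d (e, al, be) (f, mu, nu)]
      = [F^{abc}_d]_{(e,al,be)(f,mu,nu)},
        al in V^{ab}_e, be in V^{ec}_d, mu in V^{bc}_f, nu in V^{af}_d;
   [symR a b c mu nu] = [R^{ab}_c]_{mu nu},
        mu in V^{b,{}^{\bar k}a}_c, nu in V^{ab}_c;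
   [symU k a b c mu nu] = [U_k(a,b;c)]_{mu nu},
        mu in V^{{}^{\bar k}a,{}^{\bar k}b}_{{}^{\bar k}c}, nu in V^{ab}_c;
   [symeta x g h] = eta_x(g,h). *)
Record symbols (R : realType) (G : groupType) (X : gcfusion G) := Symbols {
  symF : X -> X -> X -> X -> X * nat * nat -> X * nat * nat -> R[i];
  symR : X -> X -> X -> nat -> nat -> R[i];
  symU : G -> X -> X -> X -> nat -> nat -> R[i];
  symeta : X -> G -> G -> R[i]
}.

(* The m x m' block (A i j) is a square unitary matrix. *)
Definition unitary_block (R : realType) (m m' : nat) (A : nat -> nat -> R[i]) :=
  [/\ m = m',
      forall i j, (i < m)%N -> (j < m)%N ->
        \sum_(l < m') A i l * (A j l)^* = (i == j)%:R
    & forall i j, (i < m')%N -> (j < m')%N ->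
        \sum_(l < m) A l i * (A l j)^* = (i == j)%:R].

(* The inverse of R^{ab}_c, which is its adjoint since R is unitary; it maps
   indices of V^{ab}_c (rows) to indices of V^{b,{}^{\bar k}a}_c (columns). *)
Definition symRinv (R : realType) (G : groupType) (X : gcfusion G)
  (D : symbols R X) (a b c : X) (mu nu : nat) : R[i] := (symR D a b c nu mu)^*.

(* R^{a0} = R^{0a} = 1 and, when all sectors are nonempty, the invariance of F
   and R under the G-action follow from the equations below and are not
   listed. *)
Record gcrossed (R : realType) (G : groupType) (X : gcfusion G)
    (D : symbols R X) : Prop := GCrossed {
  F_unitary_row : forall a b c d e al be e' al' be',
    (al < fusN a b e)%N -> (be < fusN e c d)%N ->
    (al' < fusN a b e')%N -> (be' < fusN e' c d)%N ->
    \sum_(f <- defects X (gr b * gr c)%g)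
      \sum_(mu < fusN b c f) \sum_(nu < fusN a f d)
        symF D a b c d (e, al, be) (f, val mu, val nu)
        * (symF D a b c d (e', al', be') (f, val mu, val nu))^*
    = ((e, al, be) == (e', al', be'))%:R;
  F_unitary_col : forall a b c d f mu nu f' mu' nu',
    (mu < fusN b c f)%N -> (nu < fusN a f d)%N ->
    (mu' < fusN b c f')%N -> (nu' < fusN a f' d)%N ->
    \sum_(e <- defects X (gr a * gr b)%g)
      \sum_(al < fusN a b e) \sum_(be < fusN e c d)
        symF D a b c d (e, val al, val be) (f, mu, nu)
        * (symF D a b c d (e, val al, val be) (f', mu', nu'))^*
    = ((f, mu, nu) == (f', mu', nu'))%:R;
  R_unitary : forall a b c,
    unitary_block (fusN b (act (gr b)^-1%g a) c) (fusN a b c) (symR D a b c);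
  U_unitary : forall k a b c,
    unitary_block (fusN (act k^-1%g a) (act k^-1%g b) (act k^-1%g c))
      (fusN a b c) (symU D k a b c);
  eta_phase : forall x g h, `|symeta D x g h| = 1;

  F_rigid : forall a,
    symF D a (dual a) a a (vac X, 0, 0)%N (vac X, 0, 0)%N != 0;

  F_unitl : forall b c d be mu,
    (be < fusN b c d)%N -> (mu < fusN b c d)%N ->
    symF D (vac X) b c d (b, 0%N, be) (d, mu, 0%N) = (be == mu)%:R;
  F_unitm : forall a c d be nu,
    (be < fusN a c d)%N -> (nu < fusN a c d)%N ->
    symF D a (vac X) c d (a, 0%N, be) (c, 0%N, nu) = (be == nu)%:R;
  F_unitr : forall a b d al nu,
    (al < fusN a b d)%N -> (nu < fusN a b d)%N ->
    symF D a b (vac X) d (d, al, 0%N) (b, 0%N, nu) = (al == nu)%:R;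
  U_unitl : forall k b, symU D k (vac X) b b 0 0 = 1;
  U_unitr : forall k a, symU D k a (vac X) a 0 0 = 1;
  U_one : forall a b c mu nu, (mu < fusN a b c)%N -> (nu < fusN a b c)%N ->
    symU D 1%g a b c mu nu = (mu == nu)%:R;
  eta_vac : forall g h, symeta D (vac X) g h = 1;
  eta_oner : forall x g, symeta D x g 1%g = 1;
  eta_onel : forall x h, symeta D x 1%g h = 1;

  (* in every equation below the external indices are those of the two bases
     being compared; sums range over the intermediate ones *)
  pentagon : forall a b c d e f g al be ga k l mu nu la,
    (al < fusN a b f)%N -> (be < fusN f c g)%N -> (ga < fusN g d e)%N ->
    (nu < fusN c d l)%N -> (mu < fusN b l k)%N -> (la < fusN a k e)%N ->
    \sum_(de < fusN f l e)
      symF D f c d e (g, be, ga) (l, nu, val de)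
      * symF D a b l e (f, al, val de) (k, mu, la)
    = \sum_(h <- defects X (gr b * gr c)%g)
        \sum_(si < fusN b c h) \sum_(ps < fusN a h g) \sum_(rho < fusN h d k)
          symF D a b c g (f, al, be) (h, val si, val ps)
          * symF D a h d e (g, val ps, ga) (k, val rho, la)
          * symF D b c d k (h, val si, val rho) (l, nu, mu);

  heptagon_R : forall a b c d e g al be mu nu,
    let kV := (gr c)^-1%g in
    (al < fusN c (act kV a) e)%N -> (be < fusN e (act kV b) d)%N ->
    (mu < fusN b c g)%N -> (nu < fusN a g d)%N ->
    \sum_(la < fusN a c e) \sum_(ga < fusN c (act kV b) g)
      symR D a c e al (val la)
      * symF D a c (act kV b) d (e, val la, be) (g, val ga, nu)
      * symR D b c g (val ga) mu
    = \sum_(f <- defects X (gr a * gr b)%g)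
        \sum_(de < fusN (act kV a) (act kV b) (act kV f))
        \sum_(si < fusN c (act kV f) d)
        \sum_(et < fusN a b f) \sum_(ps < fusN f c d)
          symF D c (act kV a) (act kV b) d
            (e, al, be) (act kV f, val de, val si)
          * symU D (gr c) a b f (val de) (val et)
          * symR D f c d (val si) (val ps)
          * symF D a b c d (f, val et, val ps) (g, mu, nu);

  heptagon_Rinv : forall a b c d e g al be mu nu,
    let c1 := act (gr a)^-1%g c in
    let c2 := act (gr b)^-1%g c1 in
    (al < fusN c a e)%N -> (be < fusN e b d)%N ->
    (mu < fusN b c2 g)%N -> (nu < fusN a g d)%N ->
    \sum_(la < fusN a c1 e) \sum_(ga < fusN c1 b g)
      symRinv D c a e al (val la)
      * symF D a c1 b d (e, val la, be) (g, val ga, nu)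
      * symRinv D c1 b g (val ga) mu
    = \sum_(f <- defects X (gr a * gr b)%g)
        \sum_(de < fusN a b f) \sum_(si < fusN c f d) \sum_(ps < fusN f c2 d)
          symF D c a b d (e, al, be) (f, val de, val si)
          * symeta D c (gr a) (gr b)
          * symRinv D c f d (val si) (val ps)
          * symF D a b c2 d (f, val de, val ps) (g, mu, nu);

  eta_cocycle : forall x g h k,
    symeta D x g h * symeta D x (g * h)%g k
    = symeta D (act g^-1%g x) h k * symeta D x g (h * k)%g;

  U_eta : forall k l a b c mu nu,
    let kV := k^-1%g in
    (mu < fusN (act (k * l)^-1%g a) (act (k * l)^-1%g b)
              (act (k * l)^-1%g c))%N ->
    (nu < fusN a b c)%N ->
    symeta D a k l * symeta D b k l
    * (\sum_(la < fusN (act kV a) (act kV b) (act kV c))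
         symU D l (act kV a) (act kV b) (act kV c) mu (val la)
         * symU D k a b c (val la) nu)
    = symU D (k * l)%g a b c mu nu * symeta D c k l
}.

(* d_a = 1 / |[F^{a \bar a a}_a]_{00}|, a nonnegative real number in R[i]. *)
Definition qdim (R : realType) (G : groupType) (X : gcfusion G)
    (D : symbols R X) (a : X) : R[i] :=
  `|symF D a (dual a) a a (vac X, 0, 0)%N (vac X, 0, 0)%N|^-1.

Definition abelian_defect (R : realType) (G : groupType) (X : gcfusion G)
    (D : symbols R X) (g : G) (a : X) : Prop :=
  gr a = g /\ qdim D a = 1.

(* Membership in the group of Abelian anyons. *)
Definition abelian_anyon (R : realType) (G : groupType) (X : gcfusion G)
    (D : symbols R X) (a : X) : Prop := abelian_defect D 1%g a.

(* theta_a for an anyon a (there {}^{gr a} a = a, so R^{aa}_c is square). *)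
Definition twist (R : realType) (G : groupType) (X : gcfusion G)
    (D : symbols R X) (a : X) : R[i] :=
  \sum_(c <- defects X 1%g) \sum_(mu < fusN a a c)
    qdim D c / qdim D a * symR D a a c (val mu) (val mu).

Definition total_qdim (R : realType) (G : groupType) (X : gcfusion G)
    (D : symbols R X) : R[i] :=
  sqrtC (\sum_(a <- defects X 1%g) qdim D a ^+ 2).

Definition Smatrix (R : realType) (G : groupType) (X : gcfusion G)
    (D : symbols R X) : 'M[R[i]]_(size (defects X 1%g)) :=
  \matrix_(i, j)
    let a := nth (vac X) (defects X 1%g) i in
    let b := nth (vac X) (defects X 1%g) j in
    (total_qdim D)^-1 *
    \sum_(c <- defects X 1%g)
      (fusN (dual a) b c)%:R * twist D c / (twist D a * twist D b) * qdim D c.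

(* The trivial sector is a modular category. *)
Definition modular (R : realType) (G : groupType) (X : gcfusion G)
    (D : symbols R X) : Prop := Smatrix D \in unitmx.

Definition no_permutation (G : groupType) (X : gcfusion G) : Prop :=
  forall (k : G) (a : X), gr a = 1%g -> act k a = a.

(* The fusion product a x b when one of a, b is Abelian, so that there is
   exactly one fusion channel (otherwise: the first channel listed). *)
Definition fus (G : groupType) (X : gcfusion G) (a b : X) : X :=
  head (vac X) [seq c <- defects X (gr a * gr b)%g | fusN a b c != 0%N].

Fixpoint fus_pow (G : groupType) (X : gcfusion G) (a : X) (n : nat) : X :=
  if n is m.+1 then fus (fus_pow a m) a else vac X.

(* R^{a,b} for Abelian a, b: the single entry of the only nonempty block. *)
Definition abR (R : realType) (G : groupType) (X : gcfusion G)
    (D : symbols R X) (a b : X) : R[i] := symR D a b (fus a b) 0 0.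

Definition abM (R : realType) (G : groupType) (X : gcfusion G)
    (D : symbols R X) (a b : X) : R[i] := abR D a b * abR D b a.

(* A-valued 2-cocycles; the coefficients carry the trivial action of G. *)
Definition abelian_cocycle (R : realType) (G : groupType) (X : gcfusion G)
    (D : symbols R X) (w : G -> G -> X) : Prop :=
  (forall k l, abelian_anyon D (w k l)) /\
  (forall k l m, fus (w k l) (w (k * l)%g m) = fus (w l m) (w k (l * m)%g)).

(* Changes of basis of the splitting spaces, |a,b;c,mu>' =
   sum_nu [Gamma^{ab}_c]_{mu nu} |a,b;c,nu>. *)
Definition vertex_param (R : realType) (G : groupType) (X : gcfusion G)
    (Gam : X -> X -> X -> nat -> nat -> R[i]) : Prop :=
  [/\ forall a b c, unitary_block (fusN a b c) (fusN a b c) (Gam a b c),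
      forall a, Gam a (vac X) a 0 0 = 1
    & forall a, Gam (vac X) a a 0 0 = 1].

Definition vertex_gauge (R : realType) (G : groupType) (X : gcfusion G)
    (Gam : X -> X -> X -> nat -> nat -> R[i]) (D : symbols R X) : symbols R X :=
  {| symF := fun a b c d (i j : X * nat * nat) =>
       let: (e, al, be) := i in let: (f, mu, nu) := j in
       \sum_(al' < fusN a b e) \sum_(be' < fusN e c d)
       \sum_(mu' < fusN b c f) \sum_(nu' < fusN a f d)
         Gam a b e al (val al') * Gam e c d be (val be')
         * symF D a b c d (e, val al', val be') (f, val mu', val nu')
         * (Gam b c f mu (val mu'))^* * (Gam a f d nu (val nu'))^*;
     symR := fun a b c mu nu =>
       let a' := act (gr b)^-1%g a in
       \sum_(mu' < fusN b a' c) \sum_(nu' < fusN a b c)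
         Gam b a' c mu (val mu') * symR D a b c (val mu') (val nu')
         * (Gam a b c nu (val nu'))^*;
     symU := fun k a b c mu nu =>
       let a' := act k^-1%g a in
       let b' := act k^-1%g b in
       let c' := act k^-1%g c in
       \sum_(mu' < fusN a' b' c') \sum_(nu' < fusN a b c)
         Gam a' b' c' mu (val mu') * symU D k a b c (val mu') (val nu')
         * (Gam a b c nu (val nu'))^*;
     symeta := symeta D |}.

Definition action_param (R : realType) (G : groupType) (X : gcfusion G)
    (gam : X -> G -> R[i]) : Prop :=
  [/\ forall a k, `|gam a k| = 1,
      forall k, gam (vac X) k = 1
    & forall a, gam a 1%g = 1].

Definition action_gauge (R : realType) (G : groupType) (X : gcfusion G)
    (gam : X -> G -> R[i]) (D : symbols R X) : symbols R X :=
  {| symF := symF D;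
     symR := fun a b c mu nu => gam a (gr b) * symR D a b c mu nu;
     symU := fun k a b c mu nu =>
       gam a k * gam b k / gam c k * symU D k a b c mu nu;
     symeta := fun x g h =>
       gam x (g * h)%g / (gam x g * gam (act g^-1%g x) h) * symeta D x g h |}.

Inductive gauge_equiv (R : realType) (G : groupType) (X : gcfusion G)
    (D : symbols R X) : symbols R X -> Prop :=
  | gauge_refl : gauge_equiv D D
  | gauge_vertex (D' : symbols R X) (Gam : X -> X -> X -> nat -> nat -> R[i]) :
      gauge_equiv D D' -> vertex_param Gam ->
      gauge_equiv D (vertex_gauge Gam D')
  | gauge_action (D' : symbols R X) (gam : X -> G -> R[i]) :
      gauge_equiv D D' -> action_param gam ->
      gauge_equiv D (action_gauge gam D').

Definition eta_ratio (R : realType) (G : groupType) (X : gcfusion G)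
    (D : symbols R X) (x : X) (g h : G) : R[i] :=
  symeta D x g h / symeta D x h g.

(* Main.v *)
Require Import Defs.
From mathcomp Require Import all_boot all_order all_algebra.
From mathcomp Require Import reals.
From mathcomp Require Import complex.
From mathcomp Require Import ring.

Set Implicit Arguments.
Unset Strict Implicit.
Unset Printing Implicit Defensive.

Import Order.TTheory GRing.Theory Num.Theory.
Local Open Scope ring_scope.

(* An object a with d_a = 1 is invertible: |[F^{a \bar a a}_a]_{00}| = 1 kills
   the other entries of the column of 0 by unitarity, while the pentagon for
   (a, \bar a, a, \bar a) would force a nonzero entry there for every channel
   t <> 0 of a x \bar a.  On invertible objects all symbols are scalars.  The
   U-eta equations for (k,l) and (l,k) show that
   lambda_a = eta_a(k,l) / eta_a(l,k) is multiplicative in objects a fixed by k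
   and l, so lambda_{0_g}^n = lambda_f.  For the anyon f the quotient of the two
   heptagons reads M_{f,xy} = M_{f,x} M_{f,y} eta_f(gr x, gr y); comparing
   x = 0_k, y = 0_l with the opposite order, where xy = b x (yx), gives
   lambda_f = M_{f,b}. *)

(** * Finite sums with a single nonzero term *)

Lemma sum_ord_eq1 (V : nmodType) (m : nat) (F : nat -> V) :
  m = 1%N -> \sum_(i < m) F (val i) = F 0%N.
Proof. by move=> ->; rewrite big_ord1. Qed.

Lemma big_seq_single (T : Type) (idx : T) {op : Monoid.com_law idx}
    (I : eqType) (s : seq I) (x0 : I) (F : I -> T) :
  uniq s -> x0 \in s -> (forall x, x \in s -> x != x0 -> F x = idx) ->
  \big[op/idx]_(x <- s) F x = F x0.
Proof.
move=> us xs F0; rewrite (bigD1_seq x0) //= big_seq_cond big1 ?Monoid.mulm1 //.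
by move=> x /andP[]; apply: F0.
Qed.

(** The summand at [x0] already exhausts the total, so nothing is left for the other nonnegative
    terms. It serves for the squared moduli in a row or column of a unitary F-matrix. *)
Lemma sum3_concentrated (V : numDomainType) (I : eqType) (s : seq I)
    (m n : I -> nat) (F : I -> nat -> nat -> V) (x0 : I) :
  uniq s -> x0 \in s -> m x0 = 1%N -> n x0 = 1%N ->
  (forall x i j, 0 <= F x i j) ->
  \sum_(x <- s) \sum_(i < m x) \sum_(j < n x) F x (val i) (val j) = 1 ->
  F x0 0%N 0%N = 1 ->
  forall x i j, x \in s -> x != x0 -> (i < m x)%N -> (j < n x)%N ->
    F x i j = 0.
Proof.
move=> us x0s m1 n1 F0 + F1 x i j xs xx0 im jn.
have S0 y : 0 <= \sum_(i < m y) \sum_(j < n y) F y (val i) (val j).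
  by apply: sumr_ge0 => ? _; apply: sumr_ge0.
rewrite (bigD1_seq x0) //= m1 n1 !big_ord1 /= F1 -[RHS]addr0 => /addrI H.
have {H} : \sum_(i < m x) \sum_(j < n x) F x (val i) (val j) = 0.
  apply/eqP; rewrite eq_le S0 andbT -[leRHS]H -big_filter.
  rewrite (bigD1_seq x) ?filter_uniq ?mem_filter ?xx0 //=.
  by rewrite lerDl; apply: sumr_ge0 => y _; apply: S0.
move=> /psumr_eq0P-/(_ (fun _ _ => sumr_ge0 _ (fun _ _ => F0 _ _ _))).
move=> /(_ (Ordinal im) isT)/= /psumr_eq0P-/(_ (fun _ _ => F0 _ _ _)).
by move=> /(_ (Ordinal jn) isT).
Qed.

(** * Quantum dimension 1 leaves the vacuum as the only channel of [a] with its dual *)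

Section Invertible.

Context (R : realType) (G : groupType) (X : gcfusion G) (D : symbols R X).

Lemma gr_vac : gr (vac X) = 1%g.
Proof.
have /fusN_gr : fusN (vac X) (vac X) (vac X) != 0%N by rewrite fusN0l eqxx.
by move=> H; apply: (@mulgI _ (gr (vac X))); rewrite mulg1.
Qed.

Lemma gr_dual (a : X) : gr (dual a) = (gr a)^-1%g.
Proof.
have /fusN_gr : fusN a (dual a) (vac X) != 0%N by rewrite fusN_dual eqxx.
by rewrite gr_vac => /esym H; rewrite -[LHS](mulKg (gr a)) H mulg1.
Qed.

Lemma fusN_dual_vac (a : X) : fusN a (dual a) (vac X) = 1%N.
Proof. by rewrite fusN_dual eqxx. Qed.

Lemma fusN_dual_vacl (a : X) : fusN (dual a) a (vac X) = 1%N.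
Proof. by rewrite fusN_dual dualK eqxx. Qed.

Lemma vac_defects : vac X \in defects X 1%g.
Proof. by rewrite mem_defects gr_vac. Qed.

(** Its modulus is 1/d_a, by definition of [qdim]. *)
Let F00 (a : X) :=
  symF D a (dual a) a a (vac X, 0, 0)%N (vac X, 0, 0)%N.

Context (hD : gcrossed D).

(* This expresses that bending the line a back and forth is invertible. *)
Lemma pentagon_bend (a t e' : X) (al be ga la : nat) :
  (al < fusN a (dual a) t)%N -> (be < fusN t a e')%N ->
  (ga < fusN e' (dual a) t)%N -> (la < fusN a (dual a) t)%N ->
  symF D t a (dual a) t (e', be, ga) (vac X, 0, 0)%N * (al == la)%:R
  = \sum_(h <- defects X 1%g)
      \sum_(si < fusN (dual a) a h) \sum_(ps < fusN a h e')
      \sum_(rho < fusN h (dual a) (dual a))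
        symF D a (dual a) a e' (t, al, be) (h, val si, val ps)
        * symF D a h (dual a) t (e', val ps, ga) (dual a, val rho, la)
        * symF D (dual a) a (dual a) (dual a)
            (h, val si, val rho) (vac X, 0, 0)%N.
Proof.
move=> hal hbe hga hla.
(* The choice [l := vac X] makes the second F-symbol on the left a Kronecker delta in [al] and
   [la]. *)
have := pentagon hD (a := a) (b := dual a) (c := a) (d := dual a) (e := t)
  (f := t) (g := e') (l := vac X) (k := dual a) (al := al) (be := be)
  (ga := ga) (la := la) (mu := 0%N) (nu := 0%N) hal hbe hga.
rewrite fusN_dual_vac fusN0r eqxx gr_dual mulVg.
move=> /(_ isT isT hla) <-.
rewrite (sum_ord_eq1 (fun de => symF D t a (dual a) t (e', be, ga)
  (vac X, 0%N, de) * symF D a (dual a) (vac X) t (t, al, de)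
  (dual a, 0%N, la))) ?fusN0r ?eqxx //.
by rewrite (F_unitr hD).
Qed.

(** The row has norm 1 by unitarity, and its entry [F00 a] alone already has modulus 1. *)
Lemma F00_row (a : X) : `|F00 a| = 1 -> forall f mu nu,
  f != vac X -> (mu < fusN (dual a) a f)%N -> (nu < fusN a f a)%N ->
  symF D a (dual a) a a (vac X, 0, 0)%N (f, mu, nu) = 0.
Proof.
move=> F1 f mu nu fv hmu hnu.
have /(_ (vac X) 0 0 (vac X) 0 0)%N := @F_unitary_row _ _ _ _ hD a (dual a) a a.
rewrite fusN_dual_vac fusN0l !eqxx gr_dual mulVg => /(_ isT isT isT isT) H.
have fd : f \in defects X 1%g.
  have /fusN_gr : fusN (dual a) a f != 0%N by rewrite -lt0n; apply: leq_trans hmu.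
  by rewrite gr_dual mulVg mem_defects => ->.
apply/eqP; rewrite -normr_eq0 -sqrf_eq0 normCK; apply/eqP.
apply: (sum3_concentrated (F := fun f mu nu =>
  symF D a (dual a) a a (vac X, 0%N, 0%N) (f, mu, nu) *
  (symF D a (dual a) a a (vac X, 0%N, 0%N) (f, mu, nu))^*)
  (defects_uniq X 1%g) vac_defects _ _ _ H) => //.
- exact: fusN_dual_vacl.
- by rewrite fusN0r eqxx.
- by move=> *; rewrite -normCK exprn_ge0.
- by rewrite -normCK -/(F00 a) F1 expr1n.
Qed.

Lemma F00_col (a : X) : `|F00 a| = 1 -> forall e al be,
  e != vac X -> (al < fusN a (dual a) e)%N -> (be < fusN e a a)%N ->
  symF D a (dual a) a a (e, al, be) (vac X, 0, 0)%N = 0.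
Proof.
move=> F1 f mu nu fv hmu hnu.
have /(_ (vac X) 0 0 (vac X) 0 0)%N := @F_unitary_col _ _ _ _ hD a (dual a) a a.
rewrite fusN_dual_vacl fusN0r !eqxx gr_dual mulgV => /(_ isT isT isT isT) H.
have fd : f \in defects X 1%g.
  have /fusN_gr : fusN a (dual a) f != 0%N by rewrite -lt0n; apply: leq_trans hmu.
  by rewrite gr_dual mulgV mem_defects => ->.
apply/eqP; rewrite -normr_eq0 -sqrf_eq0 normCK; apply/eqP.
apply: (sum3_concentrated (F := fun e al be =>
  symF D a (dual a) a a (e, al, be) (vac X, 0%N, 0%N) *
  (symF D a (dual a) a a (e, al, be) (vac X, 0%N, 0%N))^*)
  (defects_uniq X 1%g) vac_defects _ _ _ H) => //.
- exact: fusN_dual_vac.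
- by rewrite fusN0l eqxx.
- by move=> *; rewrite -normCK exprn_ge0.
- by rewrite -normCK -/(F00 a) F1 expr1n.
Qed.

(** In [pentagon_bend] with [t] the vacuum, the left side is 1 and [F00_row] leaves only the vacuum
    term on the right, so [F00 a * F00 (dual a) = 1]. *)
Lemma F00_dual (a : X) : `|F00 a| = 1 -> `|F00 (dual a)| = 1.
Proof.
move=> F1.
have := @pentagon_bend a (vac X) a 0 0 0 0.
rewrite fusN_dual_vac fusN0l eqxx => /(_ isT isT isT isT).
rewrite (F_unitl hD) ?fusN_dual_vac // mulr1.
rewrite (big_seq_single (defects_uniq X 1%g) vac_defects); last first.
  move=> h _ hv; rewrite big1 // => si _; rewrite big1 // => ps _.
  by rewrite big1 // => rho _; rewrite (F00_row F1) ?mul0r ?ltn_ord.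
rewrite fusN_dual_vacl fusN0r fusN0l !eqxx !big_ord1 /=.
rewrite (F_unitm hD) ?fusN_dual_vac //= mulr1 => /(congr1 Num.norm).
by rewrite normr1 normrM -/(F00 a) F1 mul1r /F00 dualK.
Qed.

(** A channel [t] other than the vacuum would make the whole vacuum column of F^{t,a,dual a}_t
    vanish by [pentagon_bend], although unitarity gives this column norm 1. *)
Lemma fusN_dual_abelian (a t : X) : `|F00 a| = 1 ->
  fusN a (dual a) t = (t == vac X).
Proof.
move=> F1; have [->|tv] := eqVneq t (vac X); first exact: fusN_dual_vac.
apply/eqP; apply: contraT; rewrite -lt0n => Nt.
have F1d := F00_dual F1.
have bend0 e be ga : (be < fusN t a e)%N -> (ga < fusN e (dual a) t)%N ->
    symF D t a (dual a) t (e, be, ga) (vac X, 0, 0)%N = 0.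
  move=> hbe hga; have := pentagon_bend Nt hbe hga Nt.
  rewrite eqxx mulr1 => ->.
  (* Each term has a zero factor: by [F00_col] for [dual a] when [h] is not the vacuum, and by
     [F00_col] for [a], in row [t], when it is. *)
  rewrite big1_seq // => h /andP[_ hd].
  rewrite big1 // => -[si hsi] _; rewrite big1 // => -[ps hps] _.
  rewrite big1 // => -[rho hrho] _ /=.
  have [hv|hv] := eqVneq h (vac X); last first.
    by rewrite -[X in symF D (dual a) X]dualK (F00_col F1d) ?mulr0 ?dualK.
  move: hsi hps; rewrite hv fusN_dual_vacl fusN0r.
  have [ea|//] := eqVneq a e; rewrite !ltnS !leqn0 => /eqP-> /eqP->.
  by rewrite -{}ea in hbe *; rewrite (F00_col F1) ?mul0r.
have := @F_unitary_col _ _ _ _ hD t a (dual a) t (vac X) 0%N 0%N (vac X) 0%N 0%N.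
rewrite fusN_dual_vac fusN0r !eqxx => /(_ isT isT isT isT).
rewrite big1 => [/eqP|e _]; first by rewrite eq_sym oner_eq0.
by rewrite big1 // => al _; rewrite big1 // => be _; rewrite bend0 ?mul0r ?ltn_ord.
Qed.


Lemma qdim_eq1 (a : X) : (qdim D a = 1) <-> (`|F00 a| = 1).
Proof.
by rewrite /qdim -/(F00 a); split=> [/(canRL (@invrK _))->|->]; rewrite invr1.
Qed.

Lemma qdim_dual (a : X) : qdim D a = 1 -> qdim D (dual a) = 1.
Proof. by move=> /qdim_eq1 /F00_dual /qdim_eq1. Qed.

End Invertible.

(** * Fusion with invertible objects *)

(** Left fusion with [a] has one channel, of multiplicity 1, for [c] in any sector; this is what
    reduces blocks of symbols to scalars. *)
Definition invertible (G : groupType) (X : gcfusion G) (a : X) :=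
  forall c d, fusN a c d = (d == fus a c).

Section Fusion.

Context (G : groupType) (X : gcfusion G).
Implicit Types a b c d : X.

Lemma fus_unique a b c :
  (forall d, fusN a b d = (d == c)) -> fus a b = c.
Proof.
move=> N; have Nc : fusN a b c = 1%N by rewrite N eqxx.
have cd : c \in defects X (gr a * gr b)%g.
  by rewrite mem_defects (fusN_gr (a := a) (b := b)) // Nc.
rewrite /fus (eq_filter (a2 := pred1 c)); last by move=> d; rewrite /= N eqb0 negbK.
by rewrite filter_pred1_uniq ?defects_uniq.
Qed.

Lemma invertible_fus a b c : invertible a -> fusN a b c != 0%N -> fus a b = c.
Proof. by move=> inva; rewrite inva eqb0 negbK => /eqP. Qed.

Lemma fusN_fus a b : invertible a -> fusN a b (fus a b) = 1%N.
Proof. by move=> inva; rewrite inva eqxx. Qed.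

Lemma gr_fus a b : invertible a -> gr (fus a b) = (gr a * gr b)%g.
Proof. by move=> inva; apply: fusN_gr; rewrite fusN_fus. Qed.

Lemma fus_defects a b : invertible a -> fus a b \in defects X (gr a * gr b)%g.
Proof. by move=> inva; rewrite mem_defects gr_fus. Qed.

Lemma fus0l a : fus (vac X) a = a.
Proof. by apply: fus_unique => d; rewrite fusN0l eq_sym. Qed.

Lemma invertible_vac : invertible (vac X).
Proof. by move=> c d; rewrite fusN0l fus0l eq_sym. Qed.

Lemma fus_duall a : invertible (dual a) -> fus (dual a) a = vac X.
Proof. by move=> inva; apply: invertible_fus => //; rewrite fusN_dual_vacl. Qed.

(* The matrices (N_{ac}^d) and (N_{\bar a c}^d) are inverse to each other with
   entries in nat, hence permutation matrices. *)
Lemma invertible_of_dual a :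
  (forall c, fusN a (dual a) c = (c == vac X)) ->
  (forall c, fusN (dual a) a c = (c == vac X)) -> invertible a.
Proof.
move=> Na Nda.
(* Associativity of [x], [y], [c] when [x] fuses with [y] to the vacuum: the two fusion matrices
   multiply to the identity. *)
have cancel_sum x y c d : gr x = (gr y)^-1%g ->
    (forall e, fusN x y e = (e == vac X)) ->
    (\sum_(f <- defects X (gr y * gr c)%g) fusN y c f * fusN x f d)%N
    = (c == d).
  move=> gx Nxy; rewrite -fusNA gx mulVg.
  rewrite (big_seq_single (defects_uniq X 1%g) (vac_defects X)).
    by rewrite Nxy eqxx mul1n fusN0l.
  by move=> e _ ev; rewrite Nxy (negbTE ev).
have main c f : fusN a c f != 0%N -> forall f', fusN a c f' = (f' == f).
  move=> Ncf.
  have Nfc d : d != c -> fusN (dual a) f d = 0%N.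
    move=> dc; have := cancel_sum (dual a) a c d (gr_dual a) Nda.
    move/eqP; rewrite (eq_sym c d) (negbTE dc) sum_nat_seq_eq0 => /allP/(_ f) /=.
    rewrite mem_defects (fusN_gr Ncf) eqxx => /(_ isT).
    by rewrite muln_eq0 (negbTE Ncf) => /eqP.
  (* By [Nfc], only [c] survives as intermediate object, so the opposite matrix product reduces to
     one product of naturals. *)
  have prod1 f' : (fusN (dual a) f c * fusN a c f')%N = (f == f').
    rewrite -(cancel_sum a (dual a) f f') ?gr_dual ?invgK //.
    rewrite (big_seq_single (x0 := c)) ?defects_uniq //.
      by rewrite mem_defects (fusN_gr Ncf) mulKg.
    by move=> d _ dc; rewrite Nfc.
  have := prod1 f; rewrite eqxx => /eqP; rewrite muln_eq1 => /andP[/eqP N1 _].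
  by move=> f'; rewrite eq_sym -prod1 N1 mul1n.
move=> c d; have /eqP := cancel_sum (dual a) a c c (gr_dual a) Nda.
rewrite eqxx.
(* A channel of [a] with [c] must exist: otherwise the diagonal entry at [c], which is 1, would be
   an empty sum. *)
case: (boolP (has (fun f => fusN a c f != 0%N) (defects X (gr a * gr c)%g))).
  case/hasP=> f _ /main Nf _.
  by rewrite (fus_unique Nf) Nf.
move/hasPn => N0; rewrite big1_seq // => f /andP[_ /N0].
by rewrite negbK => /eqP->.
Qed.

(** Both sides of [fusNA] collapse to one channel; the resulting formula [N] yields associativity
    and invertibility together. *)
Lemma fusA_invertible a b c : invertible a -> invertible b ->
  fus (fus a b) c = fus a (fus b c) /\ invertible (fus a b).
Proof.
move=> inva invb.
have N c' d : fusN (fus a b) c' d = (d == fus a (fus b c')).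
  have := fusNA a b c' d.
  rewrite (big_seq_single (x0 := fus a b)) ?defects_uniq ?fus_defects //; last first.
    by move=> e _ ne; rewrite inva (negbTE ne).
  rewrite (big_seq_single (x0 := fus b c')) ?defects_uniq ?fus_defects //; last first.
    by move=> e _ ne; rewrite invb (negbTE ne).
  by rewrite !fusN_fus // !mul1n inva.
have E c' : fus (fus a b) c' = fus a (fus b c') by apply: fus_unique.
by split=> // c' d; rewrite E.
Qed.

Lemma fusA a b c : invertible a -> invertible b ->
  fus (fus a b) c = fus a (fus b c).
Proof. by move=> inva invb; case: (fusA_invertible c inva invb). Qed.

Lemma invertibleM a b : invertible a -> invertible b -> invertible (fus a b).
Proof. by move=> inva invb; case: (fusA_invertible b inva invb). Qed.

Lemma invertible_pow a n : invertible a -> invertible (fus_pow a n).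
Proof.
move=> inva; elim: n => [|n IHn] /=; first exact: invertible_vac.
exact: invertibleM.
Qed.

Lemma act_fixV k a : act k a = a -> act k^-1%g a = a.
Proof. by move=> ka; rewrite -{1}ka -actM mulVg act1. Qed.

Lemma act_fus k a b : invertible a -> invertible (act k a) ->
  act k (fus a b) = fus (act k a) (act k b).
Proof.
move=> inva invka; apply/esym/invertible_fus => //.
by rewrite fusN_act fusN_fus.
Qed.

Lemma act_pow k a n : invertible a -> act k a = a ->
  act k (fus_pow a n) = fus_pow a n.
Proof.
move=> inva ka; elim: n => [|n IHn] /=; first exact: act_vac.
by rewrite act_fus ?IHn ?ka //; apply: invertible_pow.
Qed.

(** Moving the anyon [c] across [a] acts on [a] by the identity of [G]. *)
Lemma fus_anyonC a c : gr c = 1%g -> fus a c = fus c a.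
Proof.
move=> c1; rewrite /fus c1 mulg1 mul1g; congr head; apply: eq_filter => d.
by rewrite [fusN c a d]fusN_crossed c1 act1.
Qed.

End Fusion.

(** * Scalar heptagons and the monodromy with an anyon *)

Section Braiding.

Context (R : realType) (G : groupType) (X : gcfusion G) (D : symbols R X).
Context (hD : gcrossed D).

Lemma invertible_qdim (a : X) : qdim D a = 1 -> invertible a.
Proof.
move=> qa; apply: invertible_of_dual => c.
  by apply: (fusN_dual_abelian hD); apply/qdim_eq1.
rewrite -{2}(dualK a); apply: (fusN_dual_abelian hD); apply/qdim_eq1.
exact: qdim_dual.
Qed.


Lemma abR_unit (a b : X) : invertible a ->
  abR D a b * (abR D a b)^* = 1.
Proof.
move=> inva; have [+ + _] := R_unitary hD a b (fus a b).
rewrite fusN_fus // => -> /(_ 0%N 0%N isT isT).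
by rewrite big_ord1.
Qed.

Lemma symU_neq0 k (a b : X) : invertible a -> symU D k a b (fus a b) 0 0 != 0.
Proof.
move=> inva; have [+ + _] := U_unitary hD k a b (fus a b).
rewrite fusN_fus // => -> /(_ 0%N 0%N isT isT).
rewrite big_ord1 /= => H; apply/eqP => U0; move: H; rewrite U0 mul0r.
by move/eqP; rewrite eq_sym oner_eq0.
Qed.

Lemma abM_fus (a b c : X) : no_permutation X -> gr c = 1%g ->
  invertible a -> invertible b -> invertible c ->
  abM D c (fus a b) = abM D c a * abM D c b * symeta D c (gr a) (gr b).
Proof.
move=> np c1 inva invb invc.
have invab := invertibleM inva invb.
set ac := fus a c; set bc := fus b c; set ab := fus a b; set d := fus a bc.
have ca : fus c a = ac by rewrite -(fus_anyonC a c1).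
have cb : fus c b = bc by rewrite -(fus_anyonC b c1).
have abc : fus ab c = d by rewrite fusA.
have cab : fus c ab = d by rewrite -(fus_anyonC ab c1).
have acb : fus ac b = d by rewrite fusA // cb.
have invac : invertible ac by apply: invertibleM.
have Nac : fusN a c ac = 1%N by apply: fusN_fus.
have Nca : fusN c a ac = 1%N by rewrite -ca fusN_fus.
have Nbc : fusN b c bc = 1%N by apply: fusN_fus.
have Ncb : fusN c b bc = 1%N by rewrite -cb fusN_fus.
have Nab : fusN a b ab = 1%N by apply: fusN_fus.
have Nacb : fusN ac b d = 1%N by rewrite -acb fusN_fus.
have Nabc_r : fusN a bc d = 1%N by rewrite fusN_fus.
have Nabc : fusN ab c d = 1%N by rewrite -abc fusN_fus.
have Ncab : fusN c ab d = 1%N by rewrite -cab fusN_fus.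
have Nab0 f : f != ab -> fusN a b f = 0%N by rewrite inva => /negbTE->.
have actc k : act k c = c by apply: np.
(* Since [c] is an anyon, both the action by its grade and the U-symbol in this heptagon are
   trivial. *)
have H1 : abR D a c * symF D a c b d (ac, 0, 0)%N (bc, 0, 0)%N * abR D b c
  = symF D c a b d (ac, 0, 0)%N (ab, 0, 0)%N * abR D ab c
    * symF D a b c d (ab, 0, 0)%N (bc, 0, 0)%N.
  have := heptagon_R hD (a := a) (b := b) (c := c) (d := d) (e := ac) (g := bc)
    (al := 0%N) (be := 0%N) (mu := 0%N) (nu := 0%N).
  rewrite /= c1 invg1 !act1 Nca Nacb Nbc Nabc_r => /(_ isT isT isT isT).
  rewrite (big_seq_single (x0 := ab)) ?defects_uniq ?fus_defects //; last first.
    move=> f _ /Nab0 Nf; rewrite big1 // => de _; rewrite big1 // => si _.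
    by rewrite Nf big_ord0.
  rewrite !act1 Nac Ncb Nab Ncab Nabc !big_ord1 /= (U_one hD) ?Nab // mulr1.
  by rewrite /abR -/ac -/bc abc.
(* The grades of [a] and [b] may be nontrivial but fix [c], so only the factor eta remains. *)
have H2 : (abR D c a)^* * symF D a c b d (ac, 0, 0)%N (bc, 0, 0)%N
    * (abR D c b)^*
  = symF D c a b d (ac, 0, 0)%N (ab, 0, 0)%N * symeta D c (gr a) (gr b)
    * (abR D c ab)^* * symF D a b c d (ab, 0, 0)%N (bc, 0, 0)%N.
  have := heptagon_Rinv hD (a := a) (b := b) (c := c) (d := d) (e := ac)
    (g := bc) (al := 0%N) (be := 0%N) (mu := 0%N) (nu := 0%N).
  rewrite /= !actc Nca Nacb Nbc Nabc_r => /(_ isT isT isT isT).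
  rewrite (big_seq_single (x0 := ab)) ?defects_uniq ?fus_defects //; last first.
    by move=> f _ /Nab0 Nf; rewrite Nf big_ord0.
  rewrite Nac Ncb Nab Ncab Nabc !big_ord1 /= /symRinv.
  by rewrite /abR ca cb cab.
have Fneq0 : symF D a c b d (ac, 0, 0)%N (bc, 0, 0)%N != 0.
  have /(_ ac 0 0 ac 0 0)%N := @F_unitary_row _ _ _ _ hD a c b d.
  rewrite Nac Nacb => /(_ isT isT isT isT).
  rewrite (big_seq_single (x0 := bc)); first last.
  - move=> f _ fb; rewrite invc cb (negbTE fb) big_ord0 //.
  - by rewrite -cb fus_defects.
  - exact: defects_uniq.
  rewrite Ncb Nabc_r !big_ord1 /= !eqxx /= => H.
  by apply/eqP => F0; move/eqP: H; rewrite F0 mul0r eq_sym oner_eq0.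
have Ra := abR_unit a invc; have Rb := abR_unit b invc.
have Rab := abR_unit ab invc.
set F := symF D a c b d _ _ in H1 H2 Fneq0.
set P := symF D c a b d _ _ in H1 H2; set Q := symF D a b c d _ _ in H1 H2.
set y := symeta _ _ _ _ in H2 *.
(* R-symbols are phases, so the conjugates in [H2] are inverses and can be cleared. *)
have H2' : F * abR D c ab = P * Q * y * abR D c a * abR D c b.
  have -> : F = ((abR D c a)^* * F * (abR D c b)^*) * (abR D c a * abR D c b).
    transitivity (F * (abR D c a * (abR D c a)^*)
        * (abR D c b * (abR D c b)^*)); first by rewrite Ra Rb !mulr1.
    by ring.
  rewrite H2; transitivity (abR D c ab * (abR D c ab)^* *
    (P * Q * y * abR D c a * abR D c b)); last by rewrite Rab mul1r.
  by ring.
rewrite /abM; apply: (mulfI Fneq0).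
transitivity (P * abR D ab c * Q * (y * abR D c a * abR D c b)).
  by rewrite mulrA [F * _]mulrA H2'; ring.
by rewrite -H1; ring.
Qed.

(** * The ratio of eta-symbols for commuting group elements *)

Lemma eta_neq0 (x : X) g h : symeta D x g h != 0.
Proof. by rewrite -normr_eq0 (eta_phase hD) oner_eq0. Qed.

(** On fixed objects the U-eta equations for [(k,l)] and [(l,k)] contain the same U-symbols, because
    [k * l = l * k]; these cancel in the quotient. *)
Lemma eta_ratio_fus (k l : G) (a b : X) : (k * l = l * k)%g ->
  invertible a -> invertible b ->
  act k a = a -> act l a = a -> act k b = b -> act l b = b ->
  eta_ratio D (fus a b) k l = eta_ratio D a k l * eta_ratio D b k l.
Proof.
move=> kl inva invb ka la kb lb.
have U_eta_fixed k' l' : act k' a = a -> act l' a = a ->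
    act k' b = b -> act l' b = b ->
    symeta D a k' l' * symeta D b k' l'
      * (symU D l' a b (fus a b) 0 0 * symU D k' a b (fus a b) 0 0)
    = symU D (k' * l')%g a b (fus a b) 0 0 * symeta D (fus a b) k' l'.
  move=> ka' la' kb' lb'.
  have fixab h : act h a = a -> act h b = b -> act h (fus a b) = fus a b.
    by move=> ha hb; rewrite act_fus ?ha ?hb.
  have /(_ 0 0)%N := @U_eta _ _ _ _ hD k' l' a b (fus a b).
  rewrite /= fusN_act fusN_fus // => /(_ isT isT).
  rewrite (act_fixV ka') (act_fixV kb') (act_fixV (fixab k' ka' kb')).
  by rewrite fusN_fus // big_ord1.
have Ekl := U_eta_fixed k l ka la kb lb.
have Elk := U_eta_fixed l k la ka lb kb.
rewrite -kl in Elk.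
have Uk := symU_neq0 k b inva; have Ul := symU_neq0 l b inva.
have Ukl := symU_neq0 (k * l)%g b inva.
set u := symU D (k * l)%g _ _ _ _ _ in Ekl Elk Ukl.
rewrite /eta_ratio.
have -> : symeta D (fus a b) k l / symeta D (fus a b) l k
    = (u * symeta D (fus a b) k l) / (u * symeta D (fus a b) l k).
  by rewrite -mulf_div divff // mul1r.
rewrite -Ekl -Elk; field.
by rewrite !eta_neq0 Uk Ul.
Qed.

Lemma eta_ratio_vac k l : eta_ratio D (vac X) k l = 1.
Proof. by rewrite /eta_ratio !(eta_vac hD) divr1. Qed.

Lemma eta_ratio_pow (k l : G) (a : X) n : (k * l = l * k)%g ->
  invertible a -> act k a = a -> act l a = a ->
  eta_ratio D (fus_pow a n) k l = eta_ratio D a k l ^+ n.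
Proof.
move=> kl inva ka la; elim: n => [|n IHn] /=; first exact: eta_ratio_vac.
by rewrite eta_ratio_fus ?act_pow ?IHn ?exprSr //; apply: invertible_pow.
Qed.

(** Expand the monodromy of [c] with [fus a b] directly, and again through [q] and [fus b a].
    Splitting off [q] costs no eta, as its grade is 1; the monodromies with [a] and [b] cancel. *)
Lemma eta_ratio_anyon (a b q c : X) : no_permutation X -> gr c = 1%g ->
  invertible a -> invertible b -> invertible q -> invertible c ->
  fus a b = fus q (fus b a) -> gr q = 1%g ->
  eta_ratio D c (gr a) (gr b) = abM D c q.
Proof.
move=> np c1 inva invb invq invc ab q1.
have invba := invertibleM invb inva.
have M_neq0 x : invertible x -> abM D c x != 0.
  move=> invx; apply/eqP => M0.
  have := congr1 ( *%R^~ ((abR D c x)^* * (abR D x c)^*)) M0.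
  rewrite /abM /= mulrACA !abR_unit // mulr1 mul0r => /eqP.
  by rewrite oner_eq0.
have Mab := abM_fus np c1 inva invb invc.
have Mba := abM_fus np c1 invb inva invc.
have := abM_fus np c1 invq invba invc.
rewrite q1 (eta_onel hD) mulr1 -ab Mab Mba => E.
rewrite /eta_ratio; apply: (canLR (mulfK (eta_neq0 _ _ _))).
apply: (mulfI (mulf_neq0 (M_neq0 a inva) (M_neq0 b invb))).
by rewrite E; ring.
Qed.

(** For fixed [x] the gauge factor is gam_x(kl) / (gam_x(k) gam_x(l)), symmetric in the commuting
    [k] and [l]. *)
Lemma gauge_equiv_eta_ratio (D' : symbols R X) (x : X) (k l : G) :
  (k * l = l * k)%g -> act k x = x -> act l x = x ->
  gauge_equiv D D' -> eta_ratio D' x k l = eta_ratio D x k l.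
Proof.
move=> kl kx lx; elim=> [//|D1 Gam _ IH _|D1 gam _ IH [gam1 _ _]].
  exact: IH.
have gam0 y h : gam y h != 0 by rewrite -normr_eq0 gam1 oner_eq0.
rewrite -IH /eta_ratio /= !act_fixV // -kl -mulf_div.
by rewrite [gam x k * _]mulrC divff ?mul1r // mulf_neq0 ?invr_eq0 ?mulf_neq0.
Qed.

End Braiding.

Theorem mainTheorem9 (R : realType) (G : groupType) (X : gcfusion G)
    (D : symbols R X)
    (hD : gcrossed D) (hmod : modular D) (hperm : no_permutation X)
    (z : G -> X) (w : G -> G -> X)
    (hz : forall k : G, abelian_defect D k (z k)) (hz1 : z 1%g = vac X)
    (hw : abelian_cocycle D w)
    (hzw : forall k l : G, fus (z k) (z l) = fus (w k l) (z (k * l)%g))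
    (g : G) (n : nat) (f : X)
    (hgn : (g ^+ n)%g = 1%g) (hf : abelian_anyon D f)
    (hzn : fus_pow (z g) n = f)
    (r1 r2 : G)
    (h12 : (r1 * r2 = r2 * r1)%g)
    (h1g : (r1 * g = g * r1)%g) (h2g : (r2 * g = g * r2)%g)
    (ha1 : act r1 (z g) = z g) (ha2 : act r2 (z g) = z g) :
  let b := fus (w r1 r2) (dual (w r2 r1)) in
  (forall D' : symbols R X,
     gauge_equiv D D' -> eta_ratio D' (z g) r1 r2 = eta_ratio D (z g) r1 r2)
  /\ (eta_ratio D (z g) r1 r2) ^+ n = abM D f b.
Proof.
move=> b; split; first by move=> D'; apply: gauge_equiv_eta_ratio.
have invz k : invertible (z k) by apply: (invertible_qdim hD (hz k).2).
have grz k : gr (z k) = k := (hz k).1.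
have [w_ab _] := hw.
have invw k l : invertible (w k l) by apply: (invertible_qdim hD (w_ab k l).2).
have invdw k l : invertible (dual (w k l)).
  exact: (invertible_qdim hD (qdim_dual hD (w_ab k l).2)).
have invf : invertible f := invertible_qdim hD hf.2.
(* After passing from [z g] to [f], the translations are read as grades of the defects [z r1] and
   [z r2]. *)
rewrite -(eta_ratio_pow hD) // hzn -{1}(grz r1) -{1}(grz r2).
apply: eta_ratio_anyon => //; first exact: hf.1.
- exact: invertibleM.
(* Both orders of fusing [z r1] and [z r2] end in [z (r1 * r2)], with anyons [w r1 r2] and
   [w r2 r1], so they differ by [b]. *)
- rewrite !hzw -h12 /b fusA // -[fus (dual _) (fus _ _)]fusA //.
  by rewrite fus_duall // fus0l.
- by rewrite gr_fus // gr_dual !(w_ab _ _).1 invg1 mulg1.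
Qed.
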